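(* Let $\mathbf{I} = (X,f,x_0)$ be a minimal iterator; then the class $X$ is a finite set if and only if $\mathbf{I}$ is not regular.
   Context: A set $E$ is finite if $\mathcal{P}(E)$ is the only subset $\mathcal{S}$ of the power set $\mathcal{P}(E)$ such that $\varnothing \in \mathcal{S}$ and $F \cup \{e\} \in \mathcal{S}$ whenever $F \in \mathcal{S}$, $F \neq E$ and $e \in E \setminus F$ (this is equivalent to the usual notion of finiteness). $\mathsf{Fin}$ denotes the (proper) class of all finite sets; $A \approx B$ means there exists a bijective mapping $A \to B$. An iterator is a triple $\mathbf{I} = (X,f,x_0)$ with $X$ a class (a set or a proper class), $f : X \to X$ a mapping and $x_0$ an element of $X$. The assignment of finite sets in $\mathbf{I}$ is the unique mapping $\omega : \mathsf{Fin} \to X$ with $\omega(\varnothing) = x_0$ and $\omega(A \cup \{a\}) = f(\omega(A))$ for each finite set $A$ and each element $a \notin A$. A subclass $Y$ of $X$ is $f$-invariant if $f(y) \in Y$ for all $y \in Y$. $\mathbf{I}$ is minimal if the only $f$-invariant subclass of $X$ containing $x_0$ is $X$ itself; $\mathbf{I}$ is regular if $B_1 \approx B_2$ whenever $B_1, B_2$ are finite sets with $\omega(B_1) = \omega(B_2)$. *)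

(* Defs.v *)
From mathcomp Require Import all_boot.
From mathcomp Require Import boolp classical_sets functions cardinality.

Set Implicit Arguments.
Unset Strict Implicit.
Unset Printing Implicit Defensive.

Local Open Scope classical_set_scope.
Local Open Scope card_scope.

(* Sets are subsets [E : set T] of types, and a class (a set or a proper      *)
(* class) is a type.                                                          *)

Definition powerset_of {T : Type} (E : set T) : set (set T) :=
  [set F | F `<=` E].

(* The power set of [E] always has the two closure properties below, so       *)
(* "[powerset_of E] is the only such [S]" amounts to this implication.        *)
Definition is_finite {T : Type} (E : set T) : Prop :=
  forall S : set (set T),
    S `<=` powerset_of E ->
    S set0 ->
    (forall (F : set T) (e : T),
       S F -> F <> E -> (E `\` F) e -> S (F `|` [set e])) ->
    S = powerset_of E.

Lemma is_finiteE (T : Type) (E : set T) : is_finite E <-> finite_set E.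
Proof.
split=> [finE | finE S SE S0 SU].
  have PE : [set F | F `<=` E /\ finite_set F] = powerset_of E.
    apply: finE => [F [] // | | F e [FE finF] _ [Ee _]]; first by split.
    split; first by rewrite subUset; split=> // x ->.
    by rewrite finite_setU; split=> //; exact: finite_set1.
  suff [] : [set F | F `<=` E /\ finite_set F] E by [].
  by rewrite PE.
apply/seteqP; split=> // F FE.
have /finite_setP[n Fn] := sub_finite_set FE finE.
elim: n => [|n IHn] in F FE Fn *.
  by move: Fn; rewrite II0 card_eq0 => /eqP ->.
have /eq_cardSP[x Fx FDx] := Fn.
have FDE : F `\ x `<=` E by apply: subset_trans FE => y [].
rewrite -(setD1K Fx) setUC; apply: SU; first exact: IHn.
  by move=> FxE; have := FE _ Fx; rewrite -FxE => -[_]; apply.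
by split; [exact: FE | case=> _; apply].
Qed.

Lemma is_finite0 (T : Type) : is_finite (@set0 T).
Proof. exact/is_finiteE/finite_set0. Qed.

Lemma is_finiteU1 (T : Type) (A : set T) (a : T) :
  is_finite A -> is_finite (A `|` [set a]).
Proof.
move=> /is_finiteE finA; apply/is_finiteE; rewrite finite_setU.
by split=> //; exact: finite_set1.
Qed.

(* The proper class of all finite sets, over all types of elements; it lives  *)
(* in a universe strictly above the one its [elt_type]s range over.           *)
Record Fin := MkFin {
  elt_type : Type;
  elts :> set elt_type;
  elts_finite : is_finite elts }.

Arguments elts : clear implicits.
Arguments elts_finite : clear implicits.

Definition Fin0 (T : Type) : Fin := MkFin (@is_finite0 T).

Definition FinU1 (A : Fin) (a : elt_type A) : Fin :=
  MkFin (@is_finiteU1 _ A a (elts_finite A)).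

Record iterator := Iterator {
  carrier :> Type;
  iter_map : carrier -> carrier;
  iter_base : carrier }.

Definition is_assignment (I : iterator) (w : Fin -> I) : Prop :=
  (forall T : Type, w (Fin0 T) = iter_base I) /\
  (forall (A : Fin) (a : elt_type A),
     ~ elts A a -> w (FinU1 a) = iter_map (w A)).

Lemma is_assignment_exists (I : iterator) :
  exists w : Fin -> I, is_assignment w.
Proof.
have finC (A : Fin) : {n | A #= `I_n}.
  by apply/cid/finite_setP/is_finiteE; exact: (elts_finite A).
exists (fun A => iter (projT1 (finC A)) (@iter_map I) (iter_base I)).
split=> [T | A a Aa].
  case: (finC _) => n /=.
  by rewrite card_eq_sym card_eq0 => /eqP/IIn_eq0 ->.
case: (finC A) (finC (FinU1 a)) => n An [m /= Aam].
have /card_eq_II <- // : `I_n.+1 #= `I_m.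
apply: card_eq_trans Aam.
rewrite card_eq_sym; apply/eq_cardSP; exists a; first by right.
by rewrite setDUl setDv setU0 not_setD1.
Qed.

Lemma is_assignment_unique (I : iterator) (w1 w2 : Fin -> I) :
  is_assignment w1 -> is_assignment w2 -> w1 = w2.
Proof.
move=> [w10 w1U] [w20 w2U]; apply/funext => -[T E finE].
pose S : set (set T) :=
  [set F | F `<=` E /\ forall finF : is_finite F,
     w1 (MkFin finF) = w2 (MkFin finF)].
suff SE : S = powerset_of E.
  by have [] : S E by rewrite SE.
apply: finE => [F [] // | | F e [FE wF] _ [Ee Fe]].
  split=> // fin0; rewrite (Prop_irrelevance fin0 (@is_finite0 T)).
  by rewrite [LHS]w10 [RHS]w20.
split=> [|finFe]; first by rewrite subUset; split=> // x ->.
have finF : is_finite F.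
  by apply/is_finiteE; apply: sub_finite_set (iffLR (is_finiteE _) finFe) => x; left.
rewrite (Prop_irrelevance finFe (@is_finiteU1 _ F e finF)).
by rewrite [LHS](w1U (MkFin finF)) // [RHS](w2U (MkFin finF)) // wF.
Qed.

Definition assignment (I : iterator) : Fin -> I :=
  projT1 (cid (is_assignment_exists I)).

Lemma assignmentP (I : iterator) : is_assignment (assignment I).
Proof. exact: projT2 (cid (is_assignment_exists I)). Qed.

Definition invariant_under {X : Type} (f : X -> X) (Y : set X) : Prop :=
  forall y : X, Y y -> Y (f y).

Definition minimal (I : iterator) : Prop :=
  forall Y : set I, invariant_under (@iter_map I) Y -> Y (iter_base I) -> Y = setT.

Definition regular (I : iterator) : Prop :=
  forall B1 B2 : Fin, assignment I B1 = assignment I B2 -> B1 #= B2.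

(* Main.v *)
Require Import Defs.
From mathcomp Require Import all_boot.
From mathcomp Require Import boolp classical_sets functions cardinality.

(** The assignment sends a set with [n] elements to the [n]-th iterate of the
    base point ([assignment_card]), so regularity says exactly that the sequence
    of iterates is injective ([regular_iterate_inj]).  If it is, [X] contains a
    copy of [nat] and is infinite.  If instead the [i]-th and [j]-th iterates
    agree for some [i < j], the sequence closes up: the iterates of index below
    [j] form an invariant class containing [x0], which by minimality is [X]
    ([minimal_iterate_closed]), so [X] is finite. *)

Set Implicit Arguments.
Unset Strict Implicit.
Unset Printing Implicit Defensive.

Local Open Scope classical_set_scope.
Local Open Scope card_scope.

Definition iterate (I : iterator) (n : nat) : I :=
  iter n (@iter_map I) (iter_base I).

(** Deleting an element turns an [n.+1]-element set into an [n]-element one, so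
    the recursion satisfied by the assignment unfolds to iteration. *)
Lemma assignment_card (I : iterator) (A : Fin) (n : nat) :
  elts A #= `I_n -> assignment I A = iterate I n.
Proof.
have [w0 wU] := assignmentP I.
case: A => T A finA /=; elim: n A finA => [|n IHn] A finA An.
  move: An; rewrite II0 card_eq0 => /eqP A0; rewrite {}A0 in finA *.
  by rewrite (Prop_irrelevance finA (@is_finite0 T)) [LHS]w0.
have /eq_cardSP[x Ax ADx] := An.
have finD : is_finite (A `\ x).
  exact/is_finiteE/(sub_finite_set (@subDsetl _ A [set x]))/is_finiteE.
rewrite -(setD1K Ax) setUC in finA *.
rewrite (Prop_irrelevance finA (@is_finiteU1 _ _ x finD)).
rewrite [LHS](wU (MkFin finD)); last by case=> _; apply.
by rewrite IHn.
Qed.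

(** The initial segments of [nat] realise every index as the cardinality of a
    finite set, which is what recovers injectivity from regularity. *)
Lemma regular_iterate_inj (I : iterator) : regular I <-> injective (iterate I).
Proof.
split=> [regI m n mn | injI [T1 B1 fin1] [T2 B2 fin2]].
  have finI k : is_finite `I_k by exact/is_finiteE/finite_II.
  apply: card_eq_II; apply: (regI (MkFin (finI m)) (MkFin (finI n))).
  by rewrite (@assignment_card _ _ m) // (@assignment_card _ _ n).
have /is_finiteE/finite_setP[m Bm] := fin1.
have /is_finiteE/finite_setP[n Bn] := fin2.
rewrite (@assignment_card _ _ m) // (@assignment_card _ _ n) // => /injI mn.
by apply: (card_eq_trans Bm); rewrite mn card_eq_sym.
Qed.

Lemma minimal_iterate_closed (I : iterator) (i j : nat) :
  minimal I -> i < j -> iterate I i = iterate I j -> iterate I @` `I_j = setT.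
Proof.
move=> minI ij eq_ij; apply: minI => [_ [k /= kj <-]|]; last first.
  by exists 0 => //=; exact: leq_ltn_trans ij.
(* The only iterate whose successor could escape is the last one, [k = j.-1];
   its successor is the [j]-th iterate, which is also the [i]-th. *)
have [Skj|jSk] := ltnP k.+1 j; first by exists k.+1.
exists i => //; rewrite eq_ij.
by have -> : j = k.+1 by apply/eqP; rewrite eqn_leq jSk.
Qed.

Theorem theorem7p4 (I : iterator) (minI : minimal I) :
  is_finite [set: I]%classic <-> ~ regular I.
Proof.
split=> [/is_finiteE finI /regular_iterate_inj injI | nregI].
  apply: infinite_nat; rewrite -(preimage_setT (iterate I)).
  by apply: finite_preimage finI => m n _ _; exact: injI.
apply/is_finiteE; apply: contra_notP nregI => infI.
apply/regular_iterate_inj => m n.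
wlog mn : m n / m < n => [wlg eq_mn|].
  by have [/wlg|/wlg->|] := ltngtP m n => //; apply.
move=> /(minimal_iterate_closed minI mn) XE.
by case: infI; rewrite -XE; exact/finite_image/finite_II.
Qed.
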